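(* Let $\mathfrak{g}$ be a Lie algebra and let $H=(\mathfrak{g}^{D_2})_0$ be the Lie group with operation $$\left(dX_1+\tfrac12 d^2X_2\right)*\left(dY_1+\tfrac12 d^2Y_2\right)=d(X_1+Y_1)+\tfrac12 d^2\left(X_2+Y_2+[X_1,Y_1]\right)\qquad(d\in D_2).$$ For $X_1,X_2,Y_1,Y_2\in\mathfrak{g}$ consider the elements of the Lie algebra of $H$ (tangent vectors $D\to H$ at the unit element $0$) $$e\mapsto\left(d\mapsto deX_1+\tfrac12 d^2eX_2\right),\qquad e\mapsto\left(d\mapsto deY_1+\tfrac12 d^2eY_2\right)\qquad(e\in D,\ d\in D_2).$$ Then their Lie bracket in the Lie algebra of $H$ is $$e\mapsto\left(d\mapsto d^2e[X_1,Y_1]\right).$$ This agrees with the bracket of $dX_1+\tfrac12d^2X_2$ and $dY_1+\tfrac12d^2Y_2$ computed pointwise in the Lie algebra $\mathfrak{g}^{D_2}$.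
   Context: The setting is synthetic differential geometry (SDG; intuitionistic reasoning). $\mathbb{R}$ is the line, a commutative unital $\mathbb{Q}$-algebra satisfying the general Kock–Lawvere axiom for all Weil algebras. $D_n=\{d\in\mathbb{R}\mid d^{n+1}=0\}$ and $D=D_1$. A space $M$ is microlinear if $M^{(-)}$ sends to a limit diagram every finite diagram of infinitesimal spaces (spectra of Weil algebras) with cocone that $\mathbb{R}^{(-)}$ sends to a limit diagram. An $\mathbb{R}$-module $\mathbb{E}$ is Euclidean if for each $f:D\to\mathbb{E}$ there is a unique $b\in\mathbb{E}$ with $f(d)=f(0)+db$ for all $d\in D$. A Lie algebra is a Euclidean $\mathbb{R}$-module, microlinear as a space, with a bilinear, antisymmetric bracket satisfying the Jacobi identity. $(\mathfrak{g}^{D_n})_0=\{f\in\mathfrak{g}^{D_n}\mid f(0)=0\}$; elements for $n=2$ are uniquely $d\mapsto dX_1+\tfrac12d^2X_2$. A Lie group is a group $H$ that is microlinear as a space; its Lie algebra is $\{X:D\to H\mid X(0)=\text{unit}\}$ with bracket characterized by $[X,Y](e_1e_2)=X(e_1)Y(e_2)X(-e_1)Y(-e_2)$ for $e_1,e_2\in D$ (product in $H$). *)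

(* Defs.v *)
(* Synthetic differential geometry is developed here in Rocq's own
   intuitionistic logic, with types as spaces and [eq] as equality.  The
   algebraic hierarchy of MathComp is not usable for this purpose: its rings
   are choice types, in particular have decidable equality, and the
   Kock-Lawvere axiom then holds only for the trivial ring.

   Besides the logic of Rocq, only function extensionality and proof
   irrelevance are used; both are valid in every topos.  Since a topos
   satisfies the principle of unique choice, "there is a unique x with P x" is
   rendered as the type {x | unique P x}, so that the uniquely determined x can
   be used to define operations. *)
From Stdlib Require Import QArith Ring List.
From Stdlib Require Fin.
From Stdlib Require Import FunctionalExtensionality ProofIrrelevance.
From Corelib Require Import ssreflect.

Set Implicit Arguments.
Unset Strict Implicit.
Unset Printing Implicit Defensive.

Declare Scope line_scope.
Declare Scope vect_scope.
Delimit Scope line_scope with L.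
Delimit Scope vect_scope with V.

Record comring := Comring {
  ccar :> Type;
  czero : ccar;
  cone : ccar;
  cadd : ccar -> ccar -> ccar;
  cmul : ccar -> ccar -> ccar;
  csub : ccar -> ccar -> ccar;
  copp : ccar -> ccar;
  cring : ring_theory czero cone cadd cmul csub copp eq
}.
Arguments czero {_}.
Arguments cone {_}.
Arguments cadd {_}.
Arguments cmul {_}.
Arguments csub {_}.
Arguments copp {_}.
Bind Scope line_scope with ccar.

Notation "0" := czero : line_scope.
Notation "1" := cone : line_scope.
Infix "+" := cadd : line_scope.
Infix "*" := cmul : line_scope.
Infix "-" := csub : line_scope.
Notation "- x" := (copp x) : line_scope.

Fixpoint cpow (A : comring) (x : A) (n : nat) : A :=
  match n with O => 1 | S n' => x * cpow x n' end%L.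
Infix "^" := cpow : line_scope.

Record rhom (A B : comring) := Rhom {
  hom :> A -> B;
  hom_one : hom 1 = 1%L;
  hom_add : forall x y, hom (x + y) = (hom x + hom y)%L;
  hom_mul : forall x y, hom (x * y) = (hom x * hom y)%L
}.

(* [ring_morph] includes compatibility of [ofQ] with the equality [Qeq]. *)
Record qalgebra := Qalgebra {
  qring :> comring;
  ofQ : Q -> qring;
  ofQ_morph : ring_morph (@czero qring) cone cadd cmul csub copp eq
                0%Q 1%Q Qplus Qmult Qminus Qopp Qeq_bool ofQ
}.

Record rmodule (R : comring) := Rmodule {
  mcar :> Type;
  mzero : mcar;
  madd : mcar -> mcar -> mcar;
  mopp : mcar -> mcar;
  mscal : R -> mcar -> mcar;
  madd_comm : forall x y, madd x y = madd y x;
  madd_assoc : forall x y z, madd x (madd y z) = madd (madd x y) z;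
  madd_zero : forall x, madd mzero x = x;
  madd_opp : forall x, madd x (mopp x) = mzero;
  mscal_one : forall x, mscal 1 x = x;
  mscal_mul : forall a b x, mscal (a * b) x = mscal a (mscal b x);
  mscal_addl : forall a b x, mscal (a + b) x = madd (mscal a x) (mscal b x);
  mscal_addr : forall a x y, mscal a (madd x y) = madd (mscal a x) (mscal a y)
}.
Arguments mzero {_ _}.
Arguments madd {_ _}.
Arguments mopp {_ _}.
Arguments mscal {_ _}.
Bind Scope vect_scope with mcar.

Notation "0" := mzero : vect_scope.
Infix "+" := madd : vect_scope.
Notation "- x" := (mopp x) : vect_scope.
Notation "a *: x" := (mscal a%L x) (at level 40, left associativity) : vect_scope.

(* A Weil algebra: a commutative R-algebra W = R + I whose augmentation ideal
   I = {x | waug x = 0} is nilpotent and, by [wcoord], isomorphic as an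
   R-module to R^wdim. *)
Record weil (R : comring) := Weil {
  walg :> comring;
  wconst : rhom R walg;
  waug : rhom walg R;
  waug_const : forall a, waug (wconst a) = a;
  wdim : nat;
  wcoord : walg -> Fin.t wdim -> R;
  wcoord_add : forall x y i, wcoord (x + y)%L i = (wcoord x i + wcoord y i)%L;
  wcoord_scal : forall a x i, wcoord (wconst a * x)%L i = (a * wcoord x i)%L;
  wcoord_free : forall c : Fin.t wdim -> R, exists x : walg,
    unique (fun x => waug x = 0%L /\ forall i, wcoord x i = c i) x;
  wnilpotent : exists N : nat, forall l : list walg,
    length l = N -> Forall (fun x => waug x = 0%L) l ->
    fold_right cmul 1%L l = 0%L
}.

Record spec (R : comring) (W : weil R) := Spec {
  point :> rhom W R;
  point_const : forall a, point (wconst W a) = a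
}.

Definition kock_lawvere (R : comring) : Type :=
  forall (W : weil R) (f : spec W -> R),
    {w : W | unique (fun w : W => forall p : spec W, f p = p w) w}.

Record line := Line {
  line_alg :> qalgebra;
  line_KL : kock_lawvere line_alg
}.

Definition half (R : qalgebra) : R := ofQ R (1 # 2).
Arguments half {_}.

(* A finite diagram of spectra of Weil algebras, indexed by a finite directed
   graph (commutativity requirements do not affect limits), with a cocone. *)
Record cocone (R : comring) := Cocone {
  vertices : nat;
  edges : nat;
  src : Fin.t edges -> Fin.t vertices;
  tgt : Fin.t edges -> Fin.t vertices;
  obj : Fin.t vertices -> weil R;
  arr : forall a, spec (obj (src a)) -> spec (obj (tgt a));
  apex : weil R;
  leg : forall i, spec (obj i) -> spec apex;
  leg_arr : forall a s, leg (arr (a := a) s) = leg s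
}.
Arguments arr {_ _} a _.
Arguments leg {_ _} i _.

(* M^(-) sends the cocone to a limit cone. *)
Definition sends_to_limit (R : comring) (K : cocone R) (M : Type) : Type :=
  forall fam : (forall i, spec (obj (c := K) i) -> M),
    (forall a s, fam (tgt a) (arr a s) = fam (src a) s) ->
    {f : spec (apex K) -> M | unique (fun f => forall i s, f (leg i s) = fam i s) f}.

Definition microlinear (R : comring) (M : Type) : Type :=
  forall K : cocone R, sends_to_limit K R -> sends_to_limit K M.

Definition D (R : comring) (n : nat) : Type := {d : R | (d ^ S n)%L = 0%L}.
Definition Dval (R : comring) (n : nat) (d : D R n) : R := proj1_sig d.
Coercion Dval : D >-> ccar.

Lemma D_eq (R : comring) (n : nat) (d e : D R n) : (d : R) = e -> d = e.
Proof. exact: (eq_sig_hprop (fun _ => proof_irrelevance _)). Qed.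

Section DPoints.
Variable R : comring.
Add Ring R_ring : (cring R).

Lemma D1_sq (d : D R 1) : (d * d)%L = 0%L.
Proof. by case: d => d /= <-; ring. Qed.

Lemma D_zero_subproof n : ((0 : R) ^ S n)%L = 0%L.
Proof. by rewrite /=; ring. Qed.

Lemma D_opp_subproof (d : D R 1) : ((- d : R) ^ 2)%L = 0%L.
Proof. by rewrite /=; ring [(D1_sq d)]. Qed.

Lemma D_mul_subproof (d e : D R 1) : ((d * e : R) ^ 2)%L = 0%L.
Proof. by rewrite /=; ring [(D1_sq d)]. Qed.

Lemma D_add_subproof (d e : D R 1) : ((d + e : R) ^ 3)%L = 0%L.
Proof. by rewrite /=; ring [(D1_sq d) (D1_sq e)]. Qed.

Definition D_zero n : D R n := exist _ _ (D_zero_subproof n).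
Definition D_opp (d : D R 1) : D R 1 := exist _ _ (D_opp_subproof d).
Definition D_mul (d e : D R 1) : D R 1 := exist _ _ (D_mul_subproof d e).
Definition D_add (d e : D R 1) : D R 2 := exist _ _ (D_add_subproof d e).

End DPoints.
Arguments D_zero {R n}.

Definition euclidean (R : comring) (E : rmodule R) : Type :=
  forall f : D R 1 -> E,
    {b : E | unique (fun b => forall d : D R 1, f d = (f D_zero + d *: b)%V) b}.

Record lie_algebra (R : line) := LieAlgebra {
  lmod :> rmodule R;
  l_euclidean : euclidean lmod;
  l_microlinear : microlinear R lmod;
  lbr : lmod -> lmod -> lmod;
  lbr_addl : forall x y z, lbr (x + y)%V z = (lbr x z + lbr y z)%V;
  lbr_scall : forall a x y, lbr (a *: x)%V y = (a *: lbr x y)%V;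
  lbr_addr : forall x y z, lbr x (y + z)%V = (lbr x y + lbr x z)%V;
  lbr_scalr : forall a x y, lbr x (a *: y)%V = (a *: lbr x y)%V;
  lbr_antisym : forall x y, lbr x y = (- lbr y x)%V;
  lbr_jacobi : forall x y z,
    (lbr x (lbr y z) + lbr y (lbr z x) + lbr z (lbr x y))%V = 0%V
}.
Notation "[ x , y ]" := (lbr x y) (at level 0, x, y at level 99) : vect_scope.

Record lie_group (R : line) := LieGroup {
  gcar :> Type;
  gone : gcar;
  gmul : gcar -> gcar -> gcar;
  ginv : gcar -> gcar;
  gmul_assoc : forall x y z, gmul x (gmul y z) = gmul (gmul x y) z;
  gmul_onel : forall x, gmul gone x = x;
  gmul_oner : forall x, gmul x gone = x;
  gmul_invl : forall x, gmul (ginv x) x = gone;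
  gmul_invr : forall x, gmul x (ginv x) = gone;
  g_microlinear : microlinear R gcar
}.
Arguments gone {_ _}.
Arguments gmul {_ _}.
Arguments ginv {_ _}.

(* The underlying space of the Lie algebra of H; see [lie_bracket]. *)
Definition tangent (R : line) (H : lie_group R) : Type :=
  {X : D R 1 -> H | X D_zero = gone}.
Definition tangent_fun (R : line) (H : lie_group R) (X : tangent H) :
  D R 1 -> H := proj1_sig X.
Coercion tangent_fun : tangent >-> Funclass.

Lemma tangent_eq (R : line) (H : lie_group R) (X Y : tangent H) :
  (forall d, X d = Y d) -> X = Y.
Proof.
move=> e; apply: (eq_sig_hprop (fun _ => proof_irrelevance _)).
exact: functional_extensionality.
Qed.

Lemma spec_eq (R : comring) (W : weil R) (p q : spec W) :
  (forall w, p w = q w) -> p = q.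
Proof.
case: p => -[p p1 pD pM] pc; case: q => -[q q1 qD qM] qc /= e.
have {}e : p = q by exact: functional_extensionality.
subst q; have {}e : Rhom p1 pD pM = Rhom q1 qD qM by f_equal; exact: proof_irrelevance.
by revert pc qc; rewrite -e => pc qc; f_equal; exact: proof_irrelevance.
Qed.

Definition fin2 (P : Fin.t 2 -> Type) (p0 : P Fin.F1) (p1 : P (Fin.FS Fin.F1)) :
  forall i, P i :=
  fun i => Fin.caseS' i P p0 (fun j => Fin.caseS' j (fun j => P (Fin.FS j)) p1
    (Fin.case0 _)).

Definition fin3 (P : Fin.t 3 -> Type) (p0 : P Fin.F1) (p1 : P (Fin.FS Fin.F1))
  (p2 : P (Fin.FS (Fin.FS Fin.F1))) : forall i, P i :=
  fun i => Fin.caseS' i P p0 (fin2 (P := fun j => P (Fin.FS j)) p1 p2).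

Definition fin1 (P : Fin.t 1 -> Type) (p0 : P Fin.F1) : forall i, P i :=
  fun i => Fin.caseS' i P p0 (Fin.case0 _).

Local Notation "x .1" := (fst x) (at level 1, left associativity, format "x .1").
Local Notation "x .2" := (snd x) (at level 1, left associativity, format "x .2").

Section WeilAlgebras.
Variable R : comring.
Add Ring R_ring' : (cring R).
Local Open Scope line_scope.

Ltac open_pair x :=
  let T := type of x in let T := eval hnf in T in
  match T with
  | prod _ _ => let x1 := fresh "x" in let x2 := fresh "y" in
                destruct x as [x1 x2]; open_pair x1; open_pair x2
  | _ => idtac
  end.
Ltac comps :=
  repeat match goal with |- forall x : ?T, _ =>
    let T := eval hnf in T in
    match T with
    | prod _ _ => let z := fresh "z" in intro z; open_pair z
    | Fin.t _ => fail 1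
    | _ => match type of T with Prop => fail 2 | _ => intro end
    end
  end; cbn;
  repeat match goal with |- (_, _) = (_, _) => apply: f_equal2 end; try ring.

(* (a, b) stands for a + b d *)
Lemma W1_ring_theory : ring_theory (0, 0) (1, 0)
  (fun x y : R * R => (x.1 + y.1, x.2 + y.2))
  (fun x y => (x.1 * y.1, x.1 * y.2 + x.2 * y.1))
  (fun x y => (x.1 - y.1, x.2 - y.2)) (fun x => (- x.1, - x.2)) eq.
Proof. by split; comps. Qed.

Definition W1_ring : comring := Comring W1_ring_theory.

Definition W1 : weil R.
Proof.
unshelve refine (@Weil R W1_ring (@Rhom R W1_ring (fun a => (a, 0)) _ _ _)
  (@Rhom W1_ring R fst _ _ _) _ 1 (fun x => fin1 x.2) _ _ _ _); try by comps.
- by move=> x y; refine (@fin1 _ _).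
- by move=> a [x y]; refine (@fin1 _ _); cbn; ring.
- move=> c; exists (0, c Fin.F1); split; first by split=> //; refine (@fin1 _ _).
  by case=> a b [/= -> h]; rewrite -(h Fin.F1).
- exists 2%nat => -[|x [|y [|]]] //= _ h.
  inversion_clear h as [|? ? hx h']; inversion_clear h' as [|? ? hy _].
  by revert hx hy; comps => /= -> ->; comps.
Defined.

(* (a, b, c) stands for a + b d + c d^2 *)
Lemma W2_ring_theory : ring_theory (0, 0, 0) (1, 0, 0)
  (fun x y : R * R * R => (x.1.1 + y.1.1, x.1.2 + y.1.2, x.2 + y.2))
  (fun x y => (x.1.1 * y.1.1, x.1.1 * y.1.2 + x.1.2 * y.1.1,
     x.1.1 * y.2 + x.1.2 * y.1.2 + x.2 * y.1.1))
  (fun x y => (x.1.1 - y.1.1, x.1.2 - y.1.2, x.2 - y.2))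
  (fun x => (- x.1.1, - x.1.2, - x.2)) eq.
Proof. by split; comps. Qed.

Definition W2_ring : comring := Comring W2_ring_theory.

Definition W2 : weil R.
Proof.
unshelve refine (@Weil R W2_ring (@Rhom R W2_ring (fun a => (a, 0, 0)) _ _ _)
  (@Rhom W2_ring R (fun x => x.1.1) _ _ _) _ 2 (fun x => fin2 x.1.2 x.2) _ _ _ _);
  try by comps.
- by move=> x y; refine (@fin2 _ _ _).
- by move=> a [[x y] z]; refine (@fin2 _ _ _); cbn; ring.
- move=> c; exists (0, c Fin.F1, c (Fin.FS Fin.F1)).
  split; first by split=> //; refine (@fin2 _ _ _).
  by case=> -[a b] b' [/= -> h]; rewrite -(h Fin.F1) -(h (Fin.FS Fin.F1)).
- exists 3%nat => -[|x [|y [|z [|]]]] //= _ h.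
  inversion_clear h as [|? ? hx h']; inversion_clear h' as [|? ? hy h].
  inversion_clear h as [|? ? hz _].
  by revert hx hy hz; comps => /= -> -> ->; comps.
Defined.

(* (a, b, c) stands for a + b d1 + c d2, with d1 d2 = 0 *)
Lemma WA_ring_theory : ring_theory (0, 0, 0) (1, 0, 0)
  (fun x y : R * R * R => (x.1.1 + y.1.1, x.1.2 + y.1.2, x.2 + y.2))
  (fun x y => (x.1.1 * y.1.1, x.1.1 * y.1.2 + x.1.2 * y.1.1,
     x.1.1 * y.2 + x.2 * y.1.1))
  (fun x y => (x.1.1 - y.1.1, x.1.2 - y.1.2, x.2 - y.2))
  (fun x => (- x.1.1, - x.1.2, - x.2)) eq.
Proof. by split; comps. Qed.

Definition WA_ring : comring := Comring WA_ring_theory.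

Definition WA : weil R.
Proof.
unshelve refine (@Weil R WA_ring (@Rhom R WA_ring (fun a => (a, 0, 0)) _ _ _)
  (@Rhom WA_ring R (fun x => x.1.1) _ _ _) _ 2 (fun x => fin2 x.1.2 x.2) _ _ _ _);
  try by comps.
- by move=> x y; refine (@fin2 _ _ _).
- by move=> a [[x y] z]; refine (@fin2 _ _ _); cbn; ring.
- move=> c; exists (0, c Fin.F1, c (Fin.FS Fin.F1)).
  split; first by split=> //; refine (@fin2 _ _ _).
  by case=> -[a b] b' [/= -> h]; rewrite -(h Fin.F1) -(h (Fin.FS Fin.F1)).
- exists 2%nat => -[|x [|y [|]]] //= _ h.
  inversion_clear h as [|? ? hx h']; inversion_clear h' as [|? ? hy _].
  by revert hx hy; comps => /= -> ->; comps.
Defined.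

(* (a, b, c, e) stands for a + b d1 + c d2 + e d1 d2 *)
Lemma W11_ring_theory : ring_theory (0, 0, 0, 0) (1, 0, 0, 0)
  (fun x y : R * R * R * R =>
    (x.1.1.1 + y.1.1.1, x.1.1.2 + y.1.1.2, x.1.2 + y.1.2, x.2 + y.2))
  (fun x y => (x.1.1.1 * y.1.1.1, x.1.1.1 * y.1.1.2 + x.1.1.2 * y.1.1.1,
     x.1.1.1 * y.1.2 + x.1.2 * y.1.1.1,
     x.1.1.1 * y.2 + x.1.1.2 * y.1.2 + x.1.2 * y.1.1.2 + x.2 * y.1.1.1))
  (fun x y => (x.1.1.1 - y.1.1.1, x.1.1.2 - y.1.1.2, x.1.2 - y.1.2, x.2 - y.2))
  (fun x => (- x.1.1.1, - x.1.1.2, - x.1.2, - x.2)) eq.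
Proof. by split; comps. Qed.

Definition W11_ring : comring := Comring W11_ring_theory.

Definition W11 : weil R.
Proof.
unshelve refine (@Weil R W11_ring (@Rhom R W11_ring (fun a => (a, 0, 0, 0)) _ _ _)
  (@Rhom W11_ring R (fun x => x.1.1.1) _ _ _) _ 3
  (fun x => fin3 x.1.1.2 x.1.2 x.2) _ _ _ _);
  try by comps.
- by move=> x y; refine (@fin3 _ _ _ _).
- by move=> a [[[x y] z] t]; refine (@fin3 _ _ _ _); cbn; ring.
- move=> c; exists (0, c Fin.F1, c (Fin.FS Fin.F1), c (Fin.FS (Fin.FS Fin.F1))).
  split; first by split=> //; refine (@fin3 _ _ _ _).
  case=> -[[a b] b'] b'' [/= -> h].
  by rewrite -(h Fin.F1) -(h (Fin.FS Fin.F1)) -(h (Fin.FS (Fin.FS Fin.F1))).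
- exists 3%nat => -[|x [|y [|z [|]]]] //= _ h.
  inversion_clear h as [|? ? hx h']; inversion_clear h' as [|? ? hy h].
  inversion_clear h as [|? ? hz _].
  by revert hx hy hz; comps => /= -> -> ->; comps.
Defined.

Definition spec1 (d : D R 1) : spec W1.
Proof.
unshelve refine (@Spec R W1 (@Rhom W1_ring R (fun w => w.1 + w.2 * d) _ _ _) _);
  comps; ring [(D1_sq d)].
Defined.

Definition spec2 (d : D R 2) : spec W2.
Proof.
unshelve refine (@Spec R W2 (@Rhom W2_ring R (fun w => w.1.1 + w.1.2 * d + w.2 * d ^ 2) _ _ _) _);
  comps; have h : d * d * d = 0 by (case: d => d /= <-; ring).
by ring [h].
Defined.

Definition spec11 (d e : D R 1) : spec W11.
Proof.
unshelve refine (@Spec R W11 (@Rhom W11_ring R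
  (fun w => w.1.1.1 + w.1.1.2 * d + w.1.2 * e + w.2 * (d * e)) _ _ _) _);
  comps; ring [(D1_sq d) (D1_sq e)].
Defined.

Definition Daxes : Type := {p : R * R | p.1 * p.1 = 0 /\ p.2 * p.2 = 0 /\ p.1 * p.2 = 0}.
Definition Daxes_pair (p : Daxes) : R * R := proj1_sig p.
Coercion Daxes_pair : Daxes >-> prod.

Definition D_axis1 (d : D R 1) : Daxes.
Proof. by exists ((d : R), 0); cbn; rewrite (D1_sq d); repeat split; ring. Defined.

Definition D_axis2 (d : D R 1) : Daxes.
Proof. by exists (0, (d : R)); cbn; rewrite (D1_sq d); repeat split; ring. Defined.

Definition D_antidiag (d : D R 1) : Daxes.
Proof. by exists ((d : R), - d); cbn; repeat split; ring [(D1_sq d)]. Defined.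

Definition Daxes_fst (p : Daxes) : D R 1.
Proof. by exists p.1; case: p => -[x y] /= [h _]; ring [h]. Defined.

Definition Daxes_snd (p : Daxes) : D R 1.
Proof. by exists p.2; case: p => -[x y] /= [_ [h _]]; ring [h]. Defined.

Definition Daxes_add (p : Daxes) : D R 1.
Proof. by exists (p.1 + p.2); case: p => -[x y] /= [h1 [h2 h3]]; ring [h1 h2 h3]. Defined.

Lemma Daxes_eq (p q : Daxes) : (p : R * R) = q -> p = q.
Proof. exact: (eq_sig_hprop (fun _ => proof_irrelevance _)). Qed.

Definition specA (p : Daxes) : spec WA.
Proof.
unshelve refine (@Spec R WA (@Rhom WA_ring R (fun w => w.1.1 + w.1.2 * p.1 + w.2 * p.2) _ _ _) _);
  case: p => -[d e] [/= h1 [h2 h3]]; comps; ring [h1 h2 h3].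
Defined.

Lemma spec_zero (W : weil R) (s : spec W) : s (@czero W) = 0.
Proof.
have h : s (0 + 0) = s 0 + s 0 by exact: hom_add.
have e : (0 + 0 : W) = 0 by rewrite (Radd_0_l (cring W)).
rewrite e in h; have -> : s 0 = (s 0 + s 0) - s 0 by ring.
by rewrite -h; ring.
Qed.

Definition val1 (s : spec W1) : D R 1.
Proof.
exists (s (0, 1) : R); apply: eq_trans (spec_zero s); rewrite /=.
have -> : forall x : R, x * (x * 1) = x * x by move=> x; ring.
by rewrite -hom_mul; f_equal; comps.
Defined.

Definition val2 (s : spec W2) : D R 2.
Proof.
exists (s (0, 1, 0) : R); apply: eq_trans (spec_zero s); rewrite /=.
have -> : forall x : R, x * (x * (x * 1)) = x * x * x by move=> x; ring.
by rewrite -!hom_mul; f_equal; comps.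
Defined.

Definition val11l (s : spec W11) : D R 1.
Proof.
exists (s (0, 1, 0, 0) : R); apply: eq_trans (spec_zero s); rewrite /=.
have -> : forall x : R, x * (x * 1) = x * x by move=> x; ring.
by rewrite -hom_mul; f_equal; comps.
Defined.

Definition val11r (s : spec W11) : D R 1.
Proof.
exists (s (0, 0, 1, 0) : R); apply: eq_trans (spec_zero s); rewrite /=.
have -> : forall x : R, x * (x * 1) = x * x by move=> x; ring.
by rewrite -hom_mul; f_equal; comps.
Defined.

Definition valA (s : spec WA) : Daxes.
Proof.
exists (s (0, 1, 0), s (0, 0, 1)); repeat split; apply: eq_trans (spec_zero s);
  by rewrite /= -hom_mul; f_equal; comps.
Defined.

Lemma specAK p : valA (specA p) = p.
Proof. by apply: Daxes_eq; case: p => -[d e] h; cbn; apply: f_equal2; ring. Qed.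

Lemma spec1K d : val1 (spec1 d) = d.
Proof. by apply: D_eq; cbn; ring. Qed.

Lemma spec2K d : val2 (spec2 d) = d.
Proof. by apply: D_eq; cbn; ring. Qed.

Lemma spec11lK d e : val11l (spec11 d e) = d.
Proof. by apply: D_eq; cbn; ring. Qed.

Lemma spec11rK d e : val11r (spec11 d e) = e.
Proof. by apply: D_eq; cbn; ring. Qed.

Lemma val1K s : spec1 (val1 s) = s.
Proof.
apply: spec_eq => -[a b]; cbn.
rewrite -{1}(point_const s a) -{1}(point_const s b) -hom_mul -hom_add /=.
by f_equal; comps.
Qed.

Lemma val2K s : spec2 (val2 s) = s.
Proof.
apply: spec_eq => -[[a b] c]; cbn.
have -> : forall x : R, x * (x * 1) = x * x by move=> x; ring.
rewrite -{1}(point_const s a) -{1}(point_const s b) -{1}(point_const s c).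
rewrite -!hom_mul -!hom_add /=.
by f_equal; comps.
Qed.

Lemma valAK s : specA (valA s) = s.
Proof.
apply: spec_eq => -[[a b] c]; cbn.
rewrite -{1}(point_const s a) -{1}(point_const s b) -{1}(point_const s c).
rewrite -!hom_mul -!hom_add /=.
by f_equal; comps.
Qed.

Lemma val11K s : spec11 (val11l s) (val11r s) = s.
Proof.
apply: spec_eq => -[[[a b] c] e]; cbn.
rewrite -{1}(point_const s a) -{1}(point_const s b) -{1}(point_const s c).
rewrite -{1}(point_const s e) -!hom_mul -!hom_add /=.
by f_equal; comps.
Qed.

End WeilAlgebras.

(* Identities in a module E over R are checked in the commutative ring R + E
   in which E is a square-zero ideal. *)
Section TrivialExtension.
Variables (R : comring) (E : rmodule R).
Add Ring R_ring_te : (cring R).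

Lemma madd_zeror (x : E) : (x + 0)%V = x.
Proof. by rewrite madd_comm madd_zero. Qed.

Lemma madd_cancel (x y z : E) : (x + y)%V = (x + z)%V -> y = z.
Proof.
move=> e; rewrite -(madd_zero y) -(madd_zero z) -(madd_opp x) (madd_comm x).
by rewrite -!madd_assoc e.
Qed.

Lemma mscal_zerol (x : E) : (0 *: x)%V = 0%V.
Proof.
apply: (@madd_cancel (0 *: x)%V); rewrite -mscal_addl madd_zeror.
by f_equal; ring.
Qed.

Lemma mscal_zeror (a : R) : (a *: (0 : E))%V = 0%V.
Proof. by apply: (@madd_cancel (a *: 0)%V); rewrite -mscal_addr !madd_zeror. Qed.

Lemma madd_AC (x y z t : E) : (x + y + (z + t) = x + z + (y + t))%V.
Proof. by rewrite -!madd_assoc (madd_assoc y) (madd_comm y) -madd_assoc. Qed.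

Definition te_add (x y : R * E) : R * E := ((x.1 + y.1)%L, (x.2 + y.2)%V).
Definition te_mul (x y : R * E) : R * E := ((x.1 * y.1)%L, (x.1 *: y.2 + y.1 *: x.2)%V).
Definition te_opp (x : R * E) : R * E := ((- x.1)%L, (- x.2)%V).
Definition te_sub (x y : R * E) : R * E := te_add x (te_opp y).
Definition te_scal (a : R) : R * E := (a, 0%V).
Definition te_vect (x : E) : R * E := (0%L, x).

Lemma te_ring : ring_theory (te_scal 0) (te_scal 1) te_add te_mul te_sub te_opp eq.
Proof.
split; rewrite /te_add /te_mul /te_sub /te_opp /te_scal.
- by case=> a x /=; apply: f_equal2; [ring | rewrite madd_zero].
- by case=> a x [b y] /=; apply: f_equal2; [ring | rewrite madd_comm].
- by case=> a x [b y] [c z] /=; apply: f_equal2; [ring | rewrite madd_assoc].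
- by case=> a x /=; apply: f_equal2; [ring | rewrite mscal_one mscal_zeror madd_zeror].
- by case=> a x [b y] /=; apply: f_equal2; [ring | rewrite madd_comm].
- case=> a x [b y] [c z] /=; apply: f_equal2; first by ring.
  rewrite !mscal_addr -!mscal_mul -madd_assoc.
  by do 2 f_equal; f_equal; ring.
- case=> a x [b y] [c z] /=; apply: f_equal2; first by ring.
  by rewrite !mscal_addl !mscal_addr madd_AC.
- by case=> a x [b y].
- by case=> a x /=; apply: f_equal2; [ring | rewrite madd_opp].
Qed.

Lemma te_vect_inj x y : te_vect x = te_vect y -> x = y.
Proof. by case. Qed.

Lemma te_vectD x y : te_vect (x + y)%V = te_add (te_vect x) (te_vect y).
Proof. by rewrite /te_add /te_vect /=; apply: f_equal2 => //; ring. Qed.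

Lemma te_vectN x : te_vect (- x)%V = te_opp (te_vect x).
Proof. by rewrite /te_opp /te_vect /=; apply: f_equal2 => //; ring. Qed.

Lemma te_vectZ a x : te_vect (a *: x)%V = te_mul (te_scal a) (te_vect x).
Proof. by rewrite /te_mul /te_vect /= mscal_zerol madd_zeror; apply: f_equal2 => //; ring. Qed.

Lemma te_vect0 : te_vect 0%V = te_scal 0%L.
Proof. by []. Qed.

Lemma te_scalD a b : te_scal (a + b)%L = te_add (te_scal a) (te_scal b).
Proof. by rewrite /te_add /te_scal /= madd_zero. Qed.

Lemma te_scalM a b : te_scal (a * b)%L = te_mul (te_scal a) (te_scal b).
Proof. by rewrite /te_mul /te_scal /= !mscal_zeror madd_zero. Qed.

Lemma te_scalN a : te_scal (- a)%L = te_opp (te_scal a).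
Proof. by rewrite /te_opp /te_scal /= -(madd_zero (- 0)%V) madd_opp. Qed.

Definition te_E := (te_vectD, te_vectN, te_vectZ, te_vect0, te_scalD, te_scalM, te_scalN).

End TrivialExtension.

(* The goal is an equality in a module whose trivial extension has been
   declared as a ring. *)
Ltac modring := apply: te_vect_inj; rewrite ?te_E; ring.

Section Euclidean.
Variables (R : comring) (E : rmodule R) (EE : euclidean E).
Add Ring R_ring_eu : (cring R).
Add Ring E_ring_eu : (te_ring E).

Lemma euclidean_cancel (x y : E) :
  (forall d : D R 1, (d *: x = d *: y)%V) -> x = y.
Proof.
move=> e; have [b [_ bU]] := EE (fun d => d *: x)%V.
rewrite -(bU x) ?(bU y) // => d; last by rewrite e /=; modring.
by rewrite /=; modring.
Qed.

Lemma euclidean_two (F : D R 1 -> D R 1 -> E) :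
  {b : E * E * E | forall d e, F d e =
    (F D_zero D_zero + d *: b.1.1 + e *: b.1.2 + (d * e) *: b.2)%V}.
Proof.
pose s d := proj1_sig (EE (F d)).
have sE d e : F d e = (F d D_zero + e *: s d)%V by rewrite /s; case: (EE _) => b [].
have [a [aE _]] := EE (fun d => F d D_zero).
have [c [cE _]] := EE s.
exists (a, s D_zero, c) => d e; rewrite sE aE cE /=.
by modring.
Qed.

End Euclidean.

Section Line.
Variable R : line.
Add Ring R_ring_li : (cring R).

Definition regular : rmodule R.
Proof.
by unshelve refine (@Rmodule R R 0%L cadd copp cmul _ _ _ _ _ _ _ _);
  intros; ring.
Defined.

Lemma regular_euclidean : euclidean regular.
Proof.
move=> f; have [[a b] [fE wU]] := line_KL (fun s : spec (W1 R) => f (val1 s)).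
have {}fE d : f d = (a + b * d)%L by rewrite -{1}(spec1K d) fE.
exists b; split=> [d|b' b'E].
  by rewrite fE [f D_zero]fE /=; ring.
suff : (a, b) = (a, b') by case.
apply: wU => s; rewrite b'E fE -{2}(val1K s) /=.
by rewrite /spec1 /=; ring.
Qed.

Lemma line_cancel (x y : R) : (forall d : D R 1, (d * x = d * y)%L) -> x = y.
Proof. exact: (euclidean_cancel regular_euclidean). Qed.

Lemma line_D2 (f : D R 2 -> R) : {a : R * R * R |
  forall d, f d = (a.1.1 + a.1.2 * d + a.2 * d ^ 2)%L}.
Proof.
have [w [fE _]] := line_KL (fun s : spec (W2 R) => f (val2 s)).
by exists w => d; rewrite -{1}(spec2K d) fE.
Qed.

Lemma halfP : (half + half)%L = 1%L :> R.
Proof.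
rewrite /half -(morph_add (ofQ_morph R)) -(morph1 (ofQ_morph R)).
by apply: (morph_eq (ofQ_morph R)).
Qed.

(* As seen by microlinear spaces, D_add : D 1 x D 1 -> D 2 is the coequalizer of
   the identity and the swap. *)
Definition add_cocone : cocone R.
Proof.
unshelve refine (@Cocone R 1 1 (fun i => i) (fun i => i) (fun _ => W11 R)
  (fun _ s => spec11 (val11r s) (val11l s)) (W2 R)
  (fun _ s => spec2 (D_add (val11l s) (val11r s))) _).
move=> _ s; cbv beta; rewrite spec11lK spec11rK; f_equal.
by apply: D_eq; rewrite /=; ring.
Defined.

Lemma add_leg d e :
  leg (c := add_cocone) Fin.F1 (spec11 d e) = spec2 (D_add d e).
Proof. by rewrite /leg /add_cocone spec11lK spec11rK. Qed.

Lemma add_limit : sends_to_limit add_cocone R.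
Proof.
move=> fam famE; pose F d e : R := fam Fin.F1 (spec11 d e).
have FC d e : F d e = F e d.
  by rewrite /F -(famE Fin.F1 (spec11 d e)) /arr /add_cocone spec11lK spec11rK.
have [[[b1 b2] c] FE'] := euclidean_two regular_euclidean F.
have {}FE' d e : F d e = (F D_zero D_zero + d * b1 + e * b2 + d * e * c)%L.
  exact: FE'.
move: FE'; set a := F _ _ => FE.
have e12 : b1 = b2.
  apply: line_cancel => d; have := FC d D_zero.
  rewrite (FE d D_zero) (FE D_zero d) /= => h.
  have -> : (d * b1 = (a + d * b1 + 0 * b2 + d * 0 * c) - a)%L by ring.
  by rewrite h; ring.
subst b2; exists (fun s => a + b1 * val2 s + half * c * val2 s ^ 2)%L.
split=> [|f' fE'].
  apply: (fin1) => s; rewrite -(val11K s); move: (val11l s) (val11r s) => d e.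
  rewrite add_leg spec2K -/(F d e) FE /=.
  transitivity (a + b1 * (d + e) + (half + half) * (c * (d * e)))%L.
    by ring [(D1_sq d) (D1_sq e)].
  by rewrite halfP; ring.
have [[[x y] z] fE] := line_D2 (fun d => f' (spec2 d)).
have {}fE' d e : F d e = (x + y * (d + e) + (1 + 1) * z * (d * e))%L.
  by rewrite /F -(fE' Fin.F1) add_leg fE /=; ring [(D1_sq d) (D1_sq e)].
have xE : a = x by rewrite /a fE' /=; ring.
have yE : b1 = y.
  apply: line_cancel => d; transitivity (F d D_zero - a)%L.
    by rewrite FE /=; ring.
  by rewrite fE' xE /=; ring.
have zE : c = ((1 + 1) * z)%L.
  apply: line_cancel => d; apply: line_cancel => e.
  transitivity (F d e - a - b1 * d - b1 * e)%L; first by rewrite FE /=; ring.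
  by rewrite fE' xE yE /=; ring.
apply: functional_extensionality => s; rewrite -(val2K s) fE !spec2K xE yE zE.
rewrite /fst /snd; move: (val2 s) => d.
transitivity (x + y * d + (half + half) * (z * d ^ 2))%L; first by ring.
by rewrite halfP; ring.
Qed.

(* As seen by microlinear spaces, the multiplication D 1 x D 1 -> D 1 is the
   colimit of the two axes and the constant map D 1 -> D 1 x D 1. *)
Definition mul_obj : Fin.t 2 -> weil R := fin2 (P := fun _ => weil R) (W1 R) (W11 R).

Definition mul_leg : forall i, spec (mul_obj i) -> spec (W1 R) :=
  fin2 (P := fun i => spec (mul_obj i) -> spec (W1 R))
    (fun _ => spec1 D_zero)
    (fun s => spec1 (D_mul (val11l s) (val11r s))).

Definition mul_arr : Fin.t 3 -> spec (W1 R) -> spec (W11 R) :=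
  fin3 (P := fun _ => spec (W1 R) -> spec (W11 R))
    (fun s => spec11 (val1 s) D_zero) (fun s => spec11 D_zero (val1 s))
    (fun _ => spec11 D_zero D_zero).

Lemma mul_leg_arr a s :
  mul_leg (i := Fin.FS Fin.F1) (mul_arr a s) = mul_leg (i := Fin.F1) s.
Proof.
revert a; refine (@fin3 _ _ _ _); rewrite /mul_leg /mul_arr /= spec11lK spec11rK;
  by f_equal; apply: D_eq; rewrite /=; ring.
Qed.

Definition mul_cocone : cocone R :=
  @Cocone R 2 3 (fun _ => Fin.F1) (fun _ => Fin.FS Fin.F1) mul_obj mul_arr
    (W1 R) mul_leg mul_leg_arr.

Lemma mul_leg_11 d e :
  leg (c := mul_cocone) (Fin.FS Fin.F1) (spec11 d e) = spec1 (D_mul d e).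
Proof. by rewrite /leg /mul_cocone /mul_leg /= spec11lK spec11rK. Qed.

Lemma mul_leg_1 s : leg (c := mul_cocone) Fin.F1 s = spec1 D_zero.
Proof. by []. Qed.

Lemma mul_limit : sends_to_limit mul_cocone R.
Proof.
move=> fam famE; pose F d e : R := fam (Fin.FS Fin.F1) (spec11 d e).
pose G s : R := fam Fin.F1 s.
have G0 s : F D_zero D_zero = G s by exact: (famE (Fin.FS (Fin.FS Fin.F1)) s).
have Fl d : F d D_zero = F D_zero D_zero.
  by rewrite (G0 (spec1 d)) /G -(famE Fin.F1) /F /= spec1K.
have Fr d : F D_zero d = F D_zero D_zero.
  by rewrite (G0 (spec1 d)) /G -(famE (Fin.FS Fin.F1)) /F /= spec1K.
have [[[b1 b2] c] FE'] := euclidean_two regular_euclidean F.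
have {}FE' d e : F d e = (F D_zero D_zero + d * b1 + e * b2 + d * e * c)%L.
  exact: FE'.
move: G0 Fl Fr FE'; set a := F _ _ => G0 Fl Fr FE.
have {}FE d e : F d e = (a + d * e * c)%L.
  have := Fl d; have := Fr e; rewrite !FE /= => h1 h2.
  have {}h1 : (e * b2 = 0)%L.
    by transitivity (a + 0 * b1 + e * b2 + 0 * e * c - a)%L; [ring | rewrite h1; ring].
  have {}h2 : (d * b1 = 0)%L.
    by transitivity (a + d * b1 + 0 * b2 + d * 0 * c - a)%L; [ring | rewrite h2; ring].
  by rewrite h1 h2; ring.
exists (fun s => a + c * val1 s)%L; split=> [|f' fE'].
  refine (@fin2 _ _ _) => s.
    by rewrite -/(G s) -(G0 s) mul_leg_1 spec1K /=; ring.
  rewrite -(val11K s); move: (val11l s) (val11r s) => d e.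
  by rewrite mul_leg_11 spec1K -/(F d e) FE /=; ring.
have [b [bE _]] := regular_euclidean (fun d => f' (spec1 d)).
have {}FE' d e : F d e = (f' (spec1 D_zero) + d * e * b)%L.
  by rewrite /F -(fE' (Fin.FS Fin.F1)) mul_leg_11 bE.
have aE : a = f' (spec1 D_zero) by rewrite /a FE' /=; ring.
have cE : c = b.
  apply: line_cancel => d; apply: line_cancel => e.
  transitivity (F e d - a)%L; first by rewrite FE; ring.
  by rewrite FE' aE; ring.
apply: functional_extensionality => s; rewrite -(val1K s) bE -aE cE spec1K /=.
by ring.
Qed.

(* As seen by microlinear spaces, the spectrum of R[x, y] / (x^2, y^2, x y) is
   the pushout of two copies of D 1 over the point 0.  The third vertex, a copy
   of D 1 mapped constantly to 0, plays the role of that point. *)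
Definition axes_leg (i : Fin.t 3) (s : spec (W1 R)) : spec (WA R) :=
  let d := val1 s in let z := D_zero in
  fin3 (P := fun _ => spec (WA R)) (specA (D_axis1 d)) (specA (D_axis2 d))
    (specA (D_axis1 z)) i.

Definition axes_cocone : cocone R.
Proof.
unshelve refine (@Cocone R 3 2 (fun _ => Fin.FS (Fin.FS Fin.F1))
  (fin2 (P := fun _ => Fin.t 3) Fin.F1 (Fin.FS Fin.F1)) (fun _ => W1 R)
  (fun _ _ => spec1 D_zero) (WA R) axes_leg _).
refine (@fin2 _ _ _) => s; rewrite /axes_leg /= spec1K //.
by f_equal; apply: Daxes_eq.
Defined.

Lemma axes_legE :
  (forall s, leg (c := axes_cocone) Fin.F1 s = specA (D_axis1 (val1 s))) *
  (forall s, leg (c := axes_cocone) (Fin.FS Fin.F1) s = specA (D_axis2 (val1 s))) *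
  (forall s, leg (c := axes_cocone) (Fin.FS (Fin.FS Fin.F1)) s =
    specA (D_axis1 D_zero)).
Proof. by []. Qed.

Lemma axes_limit : sends_to_limit axes_cocone R.
Proof.
move=> fam famE.
have [b [bE _]] := regular_euclidean (fun d => fam Fin.F1 (spec1 d)).
have [c [cE _]] := regular_euclidean (fun d => fam (Fin.FS Fin.F1) (spec1 d)).
have {}bE s : fam Fin.F1 s = (fam Fin.F1 (spec1 D_zero) + val1 s * b)%L.
  by rewrite -{1}(val1K s) bE.
have {}cE s : fam (Fin.FS Fin.F1) s =
    (fam (Fin.FS Fin.F1) (spec1 D_zero) + val1 s * c)%L.
  by rewrite -{1}(val1K s) cE.
have h1 s := famE Fin.F1 s; have h2 s := famE (Fin.FS Fin.F1) s.
rewrite /arr /= in h1 h2.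
rewrite (h1 (spec1 D_zero)) in bE; rewrite (h2 (spec1 D_zero)) in cE.
have h3 s : fam (Fin.FS (Fin.FS Fin.F1)) s = fam (Fin.FS (Fin.FS Fin.F1)) (spec1 D_zero).
  by rewrite -(h1 s) (h1 (spec1 D_zero)).
move: bE cE h3; set a := fam _ (spec1 D_zero) => bE cE h3.
exists (fun s => a + b * (valA s).1 + c * (valA s).2)%L; split=> [|f' fE'].
  refine (@fin3 _ _ _ _) => s; rewrite axes_legE specAK ?bE ?cE ?h3 /=; by ring.
have [[[x y] z] [fE _]] := line_KL f'.
have {}fE p : f' (specA p) = (x + y * p.1 + z * p.2)%L by rewrite fE.
have xE : a = x.
  have := fE' (Fin.FS (Fin.FS Fin.F1)) (spec1 D_zero).
  by rewrite axes_legE fE /= -/a => <-; ring.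
have yE : b = y.
  apply: line_cancel => d; have := fE' Fin.F1 (spec1 d).
  rewrite axes_legE fE bE !spec1K xE /= => h.
  by transitivity (x + d * b - x)%L; [ring | rewrite -h; ring].
have zE : c = z.
  apply: line_cancel => d; have := fE' (Fin.FS Fin.F1) (spec1 d).
  rewrite axes_legE fE cE !spec1K xE /= => h.
  by transitivity (x + d * c - x)%L; [ring | rewrite -h; ring].
apply: functional_extensionality => s; rewrite -(valAK s) fE specAK xE yE zE.
by [].
Qed.

Lemma microlinear_axes (M : Type) (f g : Daxes R -> M) :
  microlinear R M -> (forall d, f (D_axis1 d) = g (D_axis1 d)) ->
  (forall d, f (D_axis2 d) = g (D_axis2 d)) -> f = g.
Proof.
move=> ML e1 e2.
have [|h [_ hU]] := ML axes_cocone axes_limit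
  (fun i s => f (valA (axes_leg i s))).
  by move=> a s; do 2 f_equal; exact: (leg_arr (c := axes_cocone)).
have [hf hg] : h = (fun s => f (valA s)) /\ h = (fun s => g (valA s)).
  split; apply: hU => //; refine (@fin3 _ _ _ _) => s;
  by rewrite -[axes_leg _ s]/(leg (c := axes_cocone) _ s) axes_legE specAK ?e1 ?e2.
apply: functional_extensionality => p; rewrite -(specAK p).
exact: (f_equal (fun k => k (specA p)) (eq_trans (eq_sym hf) hg)).
Qed.

Lemma microlinear_mul (M : Type) (F : D R 1 -> D R 1 -> M) (m : M) :
  microlinear R M -> (forall d, F d D_zero = m) -> (forall d, F D_zero d = m) ->
  {f : D R 1 -> M | unique (fun f => forall d e, f (D_mul d e) = F d e) f}.
Proof.
move=> ML Fl Fr.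
pose fam := fin2 (P := fun i => spec (mul_obj i) -> M) (fun _ => m)
  (fun s => F (val11l s) (val11r s)).
have [|f [fE fU]] := ML mul_cocone mul_limit fam.
  refine (@fin3 _ _ _ _) => s; rewrite /fam /= spec11lK spec11rK //.
exists (fun d => f (spec1 d)); split=> [d e|f' fE'].
  by rewrite -mul_leg_11 fE /fam /= spec11lK spec11rK.
have e : f = fun s => f' (val1 s).
  apply: fU; refine (@fin2 _ _ _) => s; rewrite /fam /= spec1K //.
  have -> : D_zero = D_mul (R := R) D_zero D_zero by apply: D_eq; rewrite /=; ring.
  by rewrite fE'.
by apply: functional_extensionality => d; rewrite e spec1K.
Qed.

Lemma microlinear_add (M : Type) (f g : D R 2 -> M) :
  microlinear R M -> (forall d e, f (D_add d e) = g (D_add d e)) -> f = g.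
Proof.
move=> ML fg.
have [|h [_ hU]] := ML add_cocone add_limit
  (fun _ s => f (D_add (val11l s) (val11r s))).
  by move=> a s; rewrite /arr /add_cocone spec11lK spec11rK; f_equal;
    apply: D_eq; rewrite /=; ring.
have [hf hg] : h = (fun s => f (val2 s)) /\ h = (fun s => g (val2 s)).
  by split; apply: hU => i s; rewrite /leg /add_cocone spec2K.
apply: functional_extensionality => d; rewrite -(spec2K d).
exact: (f_equal (fun k => k (spec2 d)) (eq_trans (eq_sym hf) hg)).
Qed.

End Line.

Section LieBracket.
Variables (R : line) (H : lie_group R).
Add Ring R_ring_lb : (cring R).

Lemma D_opp_zero : D_opp D_zero = D_zero :> D R 1.
Proof. by apply: D_eq; rewrite /=; ring. Qed.

Lemma tangent_opp (X : tangent H) d : gmul (X d) (X (D_opp d)) = gone.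
Proof.
have X0 : X D_zero = gone := proj2_sig X.
pose l := @Daxes_fst R; pose r := @Daxes_snd R; pose lr := @Daxes_add R.
have /(f_equal (fun f => f (D_antidiag d))) :
    (fun p => gmul (X (l p)) (X (r p))) = (fun p => X (lr p)).
  apply: microlinear_axes; first exact: g_microlinear.
    move=> e; have -> : r (D_axis1 e) = D_zero by apply: D_eq.
    by rewrite X0 gmul_oner; f_equal; apply: D_eq; rewrite /=; ring.
  move=> e; have -> : l (D_axis2 e) = D_zero by apply: D_eq.
  by rewrite X0 gmul_onel; f_equal; apply: D_eq; rewrite /=; ring.
have -> : l (D_antidiag d) = d by apply: D_eq.
have -> : r (D_antidiag d) = D_opp d by apply: D_eq.
have -> : lr (D_antidiag d) = D_zero by apply: D_eq; rewrite /=; ring.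
by rewrite X0.
Qed.

Lemma lie_bracket_exists (X Y : tangent H) :
  {Z : tangent H | unique (fun Z : tangent H => forall e1 e2 : D R 1,
     Z (D_mul e1 e2) =
     gmul (gmul (gmul (X e1) (Y e2)) (X (D_opp e1))) (Y (D_opp e2))) Z}.
Proof.
have X0 : X D_zero = gone := proj2_sig X.
have Y0 : Y D_zero = gone := proj2_sig Y.
have [||Z [ZE ZU]] := @microlinear_mul R H
  (fun e1 e2 => gmul (gmul (gmul (X e1) (Y e2)) (X (D_opp e1))) (Y (D_opp e2)))
  gone (@g_microlinear _ H).
- by move=> d; rewrite D_opp_zero Y0 !gmul_oner tangent_opp.
- by move=> d; rewrite D_opp_zero X0 gmul_onel gmul_oner tangent_opp.
- have Z0 : Z D_zero = gone.
  have -> : D_zero = D_mul (R := R) D_zero D_zero by apply: D_eq; rewrite /=; ring.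
  by rewrite ZE D_opp_zero X0 Y0 !gmul_oner.
exists (exist _ Z Z0); split=> [//|Z' Z'E]; apply: tangent_eq => d.
by change (Z d = Z' d); rewrite (ZU (tangent_fun Z')).
Qed.

Definition lie_bracket (X Y : tangent H) : tangent H :=
  proj1_sig (lie_bracket_exists X Y).

End LieBracket.

Section Power.
Variables (R : line) (T : Type).

Lemma microlinear_power (M : Type) : microlinear R M -> microlinear R (T -> M).
Proof.
move=> ML K KL fam famE.
have ft t := ML K KL (fun i s => fam i s t)
  (fun a s => f_equal (fun f => f t) (famE a s)).
exists (fun s t => proj1_sig (ft t) s); split=> [i s|f' f'E].
  by apply: functional_extensionality => t; case: (ft t) => f [].
apply: functional_extensionality => s; apply: functional_extensionality => t.
case: (ft t) => f [fE fU] /=; rewrite (fU (fun s => f' s t)) // => i s'.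
by rewrite f'E.
Qed.

Variable g : lie_algebra R.

Definition power_module : rmodule R.
Proof.
unshelve refine (@Rmodule R (T -> g) (fun _ => 0%V) (fun x y t => (x t + y t)%V)
  (fun x t => (- x t)%V) (fun a x t => (a *: x t)%V) _ _ _ _ _ _ _ _);
  intros; apply: functional_extensionality => t.
- exact: madd_comm.
- exact: madd_assoc.
- exact: madd_zero.
- exact: madd_opp.
- exact: mscal_one.
- exact: mscal_mul.
- exact: mscal_addl.
- exact: mscal_addr.
Defined.

Lemma power_euclidean : euclidean power_module.
Proof.
move=> f; have ft t := @l_euclidean _ g (fun d => f d t).
exists (fun t => proj1_sig (ft t)); split=> [d|b bE].
  by apply: functional_extensionality => t; exact: (proj1 (proj2_sig (ft t)) d).
apply: functional_extensionality => t; apply: (proj2 (proj2_sig (ft t))) => d.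
exact: (f_equal (fun k => k t) (bE d)).
Qed.

Definition power_lie : lie_algebra R.
Proof.
unshelve refine (@LieAlgebra R power_module power_euclidean
  (microlinear_power (@l_microlinear _ g)) (fun x y t => [x t, y t]%V) _ _ _ _ _ _);
  intros; apply: functional_extensionality => t.
- exact: lbr_addl.
- exact: lbr_scall.
- exact: lbr_addr.
- exact: lbr_scalr.
- exact: lbr_antisym.
- exact: lbr_jacobi.
Defined.

End Power.

Definition jet0 (R : line) (n : nat) (g : lie_algebra R) : Type :=
  {f : D R n -> g | f D_zero = 0%V}.
Definition jet0_fun (R : line) (n : nat) (g : lie_algebra R) (f : jet0 n g) :
  D R n -> g := proj1_sig f.
Coercion jet0_fun : jet0 >-> Funclass.

Lemma jet0_eq (R : line) (n : nat) (g : lie_algebra R) (f h : jet0 n g) :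
  (forall d, f d = h d) -> f = h.
Proof.
move=> e; apply: (eq_sig_hprop (fun _ => proof_irrelevance _)).
exact: functional_extensionality.
Qed.

Section JetGroup.
Variables (R : line) (g : lie_algebra R).
Add Ring R_ring_jg : (cring R).
Add Ring g_ring_jg : (te_ring g).

Lemma jet0_microlinear n : microlinear R (jet0 n g).
Proof.
move=> K KL fam famE.
have [|f [fE fU]] :=
  @microlinear_power R (D R n) g (@l_microlinear _ g) K KL (fun i s => jet0_fun (fam i s)).
  by move=> a s; rewrite famE.
have f0 s : f s D_zero = 0%V.
  have [|h [_ hU]] := @l_microlinear _ g K KL (fun i _ => 0%V); first by [].
  have /(f_equal (fun k => k s)) <- : h = (fun s => f s D_zero).
    by apply: hU => i s'; rewrite fE; exact: (proj2_sig (fam i s')).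
  by have /(f_equal (fun k => k s)) -> : h = (fun s => 0%V) by exact: hU.
exists (fun s => exist _ (f s) (f0 s)); split=> [i s|f' f'E].
  by apply: jet0_eq => d; rewrite /jet0_fun /= fE.
apply: functional_extensionality => s; apply: jet0_eq => d.
by change (f s d = f' s d); rewrite (fU (fun s => jet0_fun (f' s))) // => i s'; rewrite f'E.
Qed.

Lemma jet_subproof (X1 X2 : g) :
  ((D_zero : D R 2) *: X1 + (half * (D_zero : D R 2) ^ 2) *: X2 = 0)%V.
Proof. by rewrite /=; modring. Qed.

Definition jet (X1 X2 : g) : jet0 2 g :=
  exist _ (fun d : D R 2 => (d *: X1 + (half * d ^ 2) *: X2)%V) (jet_subproof X1 X2).

Lemma g_cancel (x y : g) : (forall d : D R 1, (d *: x = d *: y)%V) -> x = y.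
Proof. exact: (euclidean_cancel (@l_euclidean _ g)). Qed.

Lemma te_half : te_add (te_scal g half) (te_scal g half) = te_scal g 1.
Proof. by rewrite -te_scalD halfP. Qed.

Lemma jet_add (X1 X2 : g) (d e : D R 1) :
  jet X1 X2 (D_add d e) = (d *: X1 + e *: X1 + (d * e) *: X2)%V.
Proof.
rewrite /jet0_fun /=.
have -> : (half * ((d + e) * ((d + e) * 1)) = (half + half) * (d * e))%L.
  by ring [(D1_sq d) (D1_sq e)].
by rewrite halfP; modring.
Qed.

Lemma jet_inj X1 X2 Y1 Y2 : jet X1 X2 = jet Y1 Y2 -> (X1, X2) = (Y1, Y2).
Proof.
move=> e; have {}e d1 d2 : jet X1 X2 (D_add d1 d2) = jet Y1 Y2 (D_add d1 d2).
  by rewrite e.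
have e1 : X1 = Y1.
  apply: g_cancel => d; have := e d D_zero; rewrite !jet_add /= => h.
  transitivity (d *: X1 + 0 *: X1 + (d * 0) *: X2)%V; first by modring.
  by rewrite h; modring.
subst Y1; f_equal; apply: g_cancel => d1; apply: g_cancel => d2.
have := e d2 d1; rewrite !jet_add => /madd_cancel h.
by rewrite -!mscal_mul; exact: h.
Qed.

Lemma jet_coeffs (f : jet0 2 g) :
  {X : g * g | unique (fun X => f = jet X.1 X.2) X}.
Proof.
have [[[b1 b2] c] FE] := euclidean_two (@l_euclidean _ g) (fun d e => f (D_add d e)).
have f0 : f (D_add D_zero D_zero) = 0%V.
  have -> : D_add (R := R) D_zero D_zero = D_zero by apply: D_eq; rewrite /=; ring.
  exact: (proj2_sig f).
have {}FE d e : f (D_add d e) = (d *: b1 + e *: b2 + (d * e) *: c)%V.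
  by rewrite FE f0 /=; modring.
have e12 : b1 = b2.
  apply: g_cancel => d.
  transitivity (f (D_add d D_zero)); first by rewrite FE /=; modring.
  have -> : D_add d D_zero = D_add D_zero d by apply: D_eq; rewrite /=; ring.
  by rewrite FE /=; modring.
exists (b1, c); split=> [|[X1 X2]]; rewrite /fst /snd.
  apply: jet0_eq => d; move: d; apply: equal_f.
  apply: (microlinear_add (@l_microlinear _ g)) => d e.
  by rewrite FE jet_add e12.
move=> fE; apply: jet_inj; rewrite -fE.
apply: jet0_eq => d; move: d; apply: equal_f.
apply: (microlinear_add (@l_microlinear _ g)) => d e.
by rewrite FE jet_add e12.
Qed.

Definition coeff1 (f : jet0 2 g) : g := (proj1_sig (jet_coeffs f)).1.
Definition coeff2 (f : jet0 2 g) : g := (proj1_sig (jet_coeffs f)).2.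

Lemma jetE f : f = jet (coeff1 f) (coeff2 f).
Proof. by rewrite /coeff1 /coeff2; case: (jet_coeffs f) => X []. Qed.

Lemma coeffs_jet X1 X2 : (coeff1 (jet X1 X2), coeff2 (jet X1 X2)) = (X1, X2).
Proof. by apply: jet_inj; rewrite -jetE. Qed.

Definition jet_mul (f h : jet0 2 g) : jet0 2 g :=
  jet (coeff1 f + coeff1 h) (coeff2 f + coeff2 h + [coeff1 f, coeff1 h]).

Lemma jet_mulE X1 X2 Y1 Y2 :
  jet_mul (jet X1 X2) (jet Y1 Y2) = jet (X1 + Y1) (X2 + Y2 + [X1, Y1]).
Proof.
by rewrite /jet_mul; case: (coeffs_jet X1 X2) => -> ->;
  case: (coeffs_jet Y1 Y2) => -> ->.
Qed.

Definition jet_inv (f : jet0 2 g) : jet0 2 g := jet (- coeff1 f) (- coeff2 f).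

Lemma lbr_zerol (x : g) : [0, x]%V = 0%V.
Proof. by rewrite -{1}(mscal_zerol 0%V) lbr_scall mscal_zerol. Qed.

Lemma lbr_zeror (x : g) : [x, 0]%V = 0%V.
Proof. by rewrite -{1}(mscal_zerol 0%V) lbr_scalr mscal_zerol. Qed.

Lemma lbr_oppl (x y : g) : [- x, y]%V = (- [x, y])%V.
Proof.
apply: (@madd_cancel _ _ [x, y]%V).
by rewrite -lbr_addl !madd_opp lbr_zerol.
Qed.

Lemma lbr_diag (x : g) : [x, x]%V = 0%V.
Proof.
rewrite -(mscal_one [x, x]%V) -halfP mscal_addl {2}lbr_antisym.
by modring.
Qed.

Definition jet_group : lie_group R.
Proof.
unshelve refine (@LieGroup R (jet0 2 g) (jet 0 0) jet_mul jet_inv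
  _ _ _ _ _ (@jet0_microlinear 2)).
- move=> f h k; rewrite (jetE f) (jetE h) (jetE k) !jet_mulE !lbr_addl !lbr_addr.
  by f_equal; modring.
- move=> f; rewrite (jetE f) jet_mulE lbr_zerol.
  by f_equal; modring.
- move=> f; rewrite (jetE f) jet_mulE lbr_zeror.
  by f_equal; modring.
- move=> f; rewrite {2}(jetE f) jet_mulE lbr_oppl lbr_diag.
  by f_equal; modring.
- move=> f; rewrite {1}(jetE f) jet_mulE lbr_antisym lbr_oppl lbr_diag.
  by f_equal; modring.
Defined.

Lemma jet_tangent_subproof1 (X1 X2 : g) (e : D R 1) :
  (((D_zero : D R 2) * e) *: X1 + (half * (D_zero : D R 2) ^ 2 * e) *: X2)%V = 0%V.
Proof. by rewrite /=; modring. Qed.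

Definition jet_tangent_fun (X1 X2 : g) (e : D R 1) : jet_group :=
  exist _ (fun d : D R 2 => ((d * e) *: X1 + (half * d ^ 2 * e) *: X2)%V)
    (jet_tangent_subproof1 X1 X2 e).

Lemma jet_tangent_subproof2 (X1 X2 : g) : jet_tangent_fun X1 X2 D_zero = gone.
Proof. by apply: jet0_eq => d; rewrite /jet0_fun /=; modring. Qed.

Definition jet_tangent (X1 X2 : g) : tangent jet_group :=
  exist _ (jet_tangent_fun X1 X2) (jet_tangent_subproof2 X1 X2).

End JetGroup.

(* Main.v *)
From Stdlib Require Import Ring.
From Corelib Require Import ssreflect.
Require Import Defs.

(** The group [jet_group g] is a Baker-Campbell-Hausdorff group truncated after
    the first bracket, so it is nilpotent of class two: with genuine inverses,
    the commutator of the jets with coefficients (X1, X2) and (Y1, Y2) is the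
    jet with coefficients (0, 2[X1, Y1]), since [X1, Y1] appears once when X
    meets Y and once more when Y is moved past the inverse of X
    ([jet_commutator]).

    The tangent vectors of the theorem are e |-> jet (e X1) (e X2), and their
    value at - e is the inverse of their value at e.  Hence the group commutator
    that defines the Lie bracket equals jet 0 (2 e1 e2 [X1, Y1]), which depends
    on e1 e2 only and is the value at e1 e2 of the tangent vector
    e |-> jet 0 (2 e [X1, Y1]).  By the uniqueness part of microlinearity
    ([lie_bracket_unique]) this is the bracket ([lie_bracket_jet_tangent]).  As
    jets carry the factor 1/2 in degree two, its value at d is d^2 e [X1, Y1].

    In the pointwise bracket, bilinearity gives d^2 [X1, Y1] and terms whose
    coefficients are multiples of d^3 = 0 ([lbr_jets]). *)

Set Implicit Arguments.
Unset Strict Implicit.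
Unset Printing Implicit Defensive.

Lemma lie_bracket_unique (R : line) (H : lie_group R) (X Y Z : tangent H) :
  (forall e1 e2 : D R 1, Z (D_mul e1 e2) =
     gmul (gmul (gmul (X e1) (Y e2)) (X (D_opp e1))) (Y (D_opp e2))) ->
  lie_bracket X Y = Z.
Proof.
rewrite /lie_bracket; case: (lie_bracket_exists X Y) => W [_ WU] /= ZE.
exact: WU.
Qed.

Section JetBracket.
Variables (R : line) (g : lie_algebra R).
Add Ring R_ring_jb : (cring R).
Add Ring g_ring_jb : (te_ring g).

Lemma jet_invE (X1 X2 : g) : jet_inv (jet X1 X2) = jet (- X1)%V (- X2)%V.
Proof. by rewrite /jet_inv; case: (coeffs_jet X1 X2) => -> ->. Qed.

Lemma lbr_oppr (x y : g) : [x, - y]%V = (- [x, y])%V.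
Proof. by rewrite lbr_antisym lbr_oppl -lbr_antisym. Qed.

Lemma jet_commutator (X1 X2 Y1 Y2 : g) :
  jet_mul (jet_mul (jet_mul (jet X1 X2) (jet Y1 Y2)) (jet_inv (jet X1 X2)))
    (jet_inv (jet Y1 Y2)) = jet 0%V ([X1, Y1] + [X1, Y1])%V.
Proof.
rewrite !jet_invE !jet_mulE !lbr_addl !lbr_oppl !lbr_oppr !lbr_diag.
rewrite (lbr_antisym Y1 X1).
by f_equal; modring.
Qed.

(** The infinitesimal parameter of a tangent vector scales both coefficients;
    in this form the group law can be applied to its values. *)
Lemma jet_tangentE (X1 X2 : g) (e : D R 1) :
  jet_tangent X1 X2 e = jet (e *: X1)%V (e *: X2)%V :> jet0 2 g.
Proof. by apply: jet0_eq => d; rewrite /jet0_fun /=; modring. Qed.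

Lemma jet_tangent_opp (X1 X2 : g) (e : D R 1) :
  jet_tangent X1 X2 (D_opp e) = jet_inv (jet_tangent X1 X2 e).
Proof. by rewrite !jet_tangentE jet_invE; f_equal; rewrite /=; modring. Qed.

Lemma lie_bracket_jet_tangent (X1 X2 Y1 Y2 : g) :
  lie_bracket (jet_tangent X1 X2) (jet_tangent Y1 Y2) =
  jet_tangent 0%V ([X1, Y1] + [X1, Y1])%V.
Proof.
apply: lie_bracket_unique => e1 e2.
rewrite !jet_tangent_opp !jet_tangentE /= jet_commutator lbr_scall lbr_scalr.
by f_equal; modring.
Qed.

(** Doubling cancels the factor 1/2 in degree two of a jet. *)
Lemma jet_tangent_double (B : g) (e : D R 1) (d : D R 2) :
  jet0_fun (jet_tangent 0%V (B + B)%V e) d = ((d ^ 2 * e) *: B)%V.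
Proof.
rewrite jet_tangentE /jet0_fun /=.
transitivity (((half + half) * (d * (d * 1) * e)) *: B)%V; first by modring.
by rewrite halfP; modring.
Qed.

Lemma D2_cube (d : D R 2) : (d * (d * d) = 0)%L.
Proof. by case: d => d /= <-; ring. Qed.

Lemma lbr_jets (X1 X2 Y1 Y2 : g) (d : D R 2) :
  [jet X1 X2 d, jet Y1 Y2 d]%V = (d ^ 2 *: [X1, Y1])%V.
Proof.
have d3 : te_mul (te_scal g d) (te_mul (te_scal g d) (te_scal g d)) = te_scal g 0.
  by rewrite -!te_scalM D2_cube.
rewrite /jet0_fun /= !lbr_addl !lbr_addr !lbr_scall !lbr_scalr.
by apply: te_vect_inj; rewrite !te_E; ring [d3].
Qed.

End JetBracket.

Theorem theorem32 (R : line) (g : lie_algebra R) (X1 X2 Y1 Y2 : g) :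
  let H : lie_group R := jet_group g in
  let X : tangent H := jet_tangent X1 X2 in
  let Y : tangent H := jet_tangent Y1 Y2 in
  let gD2 : lie_algebra R := power_lie (D R 2) g in
  (forall (e : D R 1) (d : D R 2),
     jet0_fun (lie_bracket X Y e) d = ((d ^ 2 * e) *: [X1, Y1])%V) /\
  (forall (e : D R 1) (d : D R 2),
     jet0_fun (lie_bracket X Y e) d =
     (e *: @lbr R gD2 (jet0_fun (jet X1 X2)) (jet0_fun (jet Y1 Y2)) d)%V).
Proof.
move=> H X Y gD2.
have E e d : jet0_fun (lie_bracket X Y e) d = ((d ^ 2 * e) *: [X1, Y1])%V.
  by rewrite lie_bracket_jet_tangent; exact: jet_tangent_double.
split=> // e d.
transitivity (e *: [jet X1 X2 d, jet Y1 Y2 d])%V; last by [].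
by rewrite E lbr_jets -mscal_mul (Rmul_comm (cring R)).
Qed.
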